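(* Let $L>0$ be fixed and let $(a,k)\in(-\infty,0)\times(0,1)$. If $a=c<0$, $b=d>0$ and $a+b=\frac16$, then the system $$-\omega \varphi+\psi+\varphi \psi+a \psi''+b\omega \varphi''-A_1=0,\qquad -\omega \psi+\varphi+\tfrac{1}{2}\psi^2+c\varphi''+d\omega \psi''-A_2=0,$$ with $\omega=0$ and for some real constants $A_1,A_2$, has $L$-periodic solutions $(\varphi,\psi)=(\varphi,B\varphi)\in C^\infty_{per}([0,L])\times C^\infty_{per}([0,L])$ with $B=\pm\sqrt2$ and $\varphi$ of the cnoidal form $$\varphi(x)=b_0+b_2\,\mathrm{cn}^2\left(\frac{2K(k)}{L}x,k\right).$$ The parameters $b_0$ and $b_2$ depend smoothly on $a\in(-\infty,0)$ and $k\in(0,1)$ and are given by $$b_0=-\frac12\,\frac{(32k^2-16)\,a\,K(k)^2+L^2}{L^2},\qquad b_2=\frac{24K(k)^2\,a\,k^2}{L^2}.$$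
   Context: $K(k)$ is the complete elliptic integral of the first kind with modulus $k$, and $\mathrm{cn}(\cdot,k)$ is the Jacobi cnoidal function with modulus $k$. $C^\infty_{per}([0,L])$ is the space of real-valued smooth $L$-periodic functions. *)

(* Defs.v *)
From Stdlib Require Import Reals.
From Coquelicot Require Import Coquelicot.
Open Scope R_scope.

(** Legendre's incomplete elliptic integral of the first kind, with modulus [k]
    (not parameter [m = k^2]) and amplitude [theta]. *)
Definition ellipticF (theta k : R) : R :=
  RInt (fun t => / sqrt (1 - k ^ 2 * sin t ^ 2)) 0 theta.

Definition ellipticK (k : R) : R := ellipticF (PI / 2) k.

(** Jacobi amplitude: the inverse of [theta |-> ellipticF theta k], which for
    [0 < k < 1] is an increasing bijection of the real line; [iota] selects the
    unique solution. *)
Definition jacobi_am (u k : R) : R :=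
  iota (fun theta : R => ellipticF theta k = u).

Definition jacobi_cn (u k : R) : R := cos (jacobi_am u k).

Definition smooth_periodic (L : R) (f : R -> R) : Prop :=
  (forall n x, ex_derive_n f n x) /\ (forall x, f (x + L) = f x).

Definition travelling_wave_system (omega a b c d A1 A2 : R) (phi psi : R -> R)
  : Prop :=
  forall x : R,
    - omega * phi x + psi x + phi x * psi x
      + a * Derive_n psi 2 x + b * omega * Derive_n phi 2 x - A1 = 0 /\
    - omega * psi x + phi x + 1 / 2 * psi x ^ 2
      + c * Derive_n phi 2 x + d * omega * Derive_n psi 2 x - A2 = 0.

(** Joint C^n regularity on a set [D] of the plane; meaningful for open [D],
    where [Derive] at a point of [D] only depends on values taken in [D]. *)
Fixpoint Cn_on (n : nat) (D : R -> R -> Prop) (f : R -> R -> R) : Prop :=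
  (forall x y, D x y -> continuity_2d_pt f x y) /\
  match n with
  | O => True
  | S m =>
      (forall x y, D x y ->
         ex_derive (fun t => f t y) x /\ ex_derive (fun t => f x t) y) /\
      Cn_on m D (fun x y => Derive (fun t => f t y) x) /\
      Cn_on m D (fun x y => Derive (fun t => f x t) y)
  end.

Definition smooth_on (D : R -> R -> Prop) (f : R -> R -> R) : Prop :=
  forall n, Cn_on n D f.

(* Main.v *)
Require Import Defs.
From Stdlib Require Import Reals Lra Lia Ranalysis5.
From Coquelicot Require Import Coquelicot.
Open Scope R_scope.

(** With [omega = 0] and [psi = B * phi], the first equation is [B] times
    [a phi'' + phi + phi^2 = const], and since [B^2 = 2] the second one is that
    same equation (here [c = a]).  So everything reduces to one scalar equation.

    The square [y = cn^2] satisfies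
    [y'' = 2 (1 - k^2) + 4 (2 k^2 - 1) y - 6 k^2 y^2] ([is_derive_cn_sqr'']).
    Substituting [phi = b0 + b2 y (s x)] with [s = 2 K / L], the coefficient of
    [y^2] forces [b2 = 6 a k^2 s^2] and that of [y] forces
    [b0 = - 1 / 2 - 2 a s^2 (2 k^2 - 1)]; these are the announced values
    ([cnoidal_profile_ode]).

    The calculus of [cn] comes from the amplitude.  The integral [ellipticF] has
    derivative [1 / Delta >= 1], where [Delta = sqrt (1 - k^2 sin^2)], so it is
    a bijection of the line whose inverse is 1-Lipschitz with derivative [Delta]
    ([is_derive_jacobi_am]).  As [Delta] has period [PI] and [ellipticF] is odd,
    adding [PI] to the amplitude adds [2 K] to the argument; hence [cn^2] has
    period [2 K] and [phi] has period [L].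

    Both smoothness claims use the same principle: a class of functions that
    contains the derivatives of its members consists of smooth functions.  In
    [x] the class is the algebra generated by [phi] and [phi'], closed because
    the equation makes [phi''] a polynomial in [phi].  In [(a, k)] it is the
    algebra generated by [a], [k] and the integrals
    [I_n k] of [sin^(2n) / Delta^(2n+1)] over [[0, PI/2]], closed because
    [I_n' = (2n + 1) k I_(n+1)]; it contains [K = I_0]. *)

(** * Smoothness in two variables from closure under partial derivatives *)

(** Openness of [D] turns equality on [D] into equality near
    each point of [D], which is what [Derive] sees. *)
Lemma Cn_on_ext (D : R -> R -> Prop) :
  (forall x y, D x y -> locally_2d D x y) ->
  forall n f g, (forall x y, D x y -> f x y = g x y) ->
  Cn_on n D f -> Cn_on n D g.
Proof.
intros HD n; induction n as [|n IH]; intros f g Hfg Hf; destruct Hf as [Hc Hf].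
all: assert (Hloc : forall x y, D x y -> locally_2d (fun u v => f u v = g u v) x y)
  by (intros x y Hxy; destruct (HD x y Hxy) as [d Hd]; exists d; auto).
all: split; [intros x y Hxy; apply continuity_2d_pt_ext_loc with f; auto|].
- exact I.
- destruct Hf as [He [H1 H2]].
  split; [|split].
  + intros x y Hxy; destruct (He x y Hxy) as [E1 E2]; split.
    * apply ex_derive_ext_loc with (2 := E1).
      apply (locally_2d_1d_const_y (fun u v => f u v = g u v)); auto.
    * apply ex_derive_ext_loc with (2 := E2).
      apply (locally_2d_1d_const_x (fun u v => f u v = g u v)); auto.
  + revert H1; apply IH; intros x y Hxy; apply Derive_ext_loc.
    apply (locally_2d_1d_const_y (fun u v => f u v = g u v)); auto.
  + revert H2; apply IH; intros x y Hxy; apply Derive_ext_loc.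
    apply (locally_2d_1d_const_x (fun u v => f u v = g u v)); auto.
Qed.

(** Membership in [C] replaces an induction over all mixed partial derivatives:
    the induction is on the order only, for all members of [C] at once. *)
Lemma smooth_on_of_closed_class (D : R -> R -> Prop)
    (C : (R -> R -> R) -> Prop) :
  (forall x y, D x y -> locally_2d D x y) ->
  (forall f, C f ->
     (forall x y, D x y -> continuity_2d_pt f x y) /\
     (exists g, C g /\
        forall x y, D x y -> is_derive (fun t => f t y) x (g x y)) /\
     (exists g, C g /\
        forall x y, D x y -> is_derive (fun t => f x t) y (g x y))) ->
  forall f, C f -> smooth_on D f.
Proof.
intros HD HC f Hf n; revert f Hf.
induction n as [|n IH]; intros f Hf;
  destruct (HC f Hf) as [Hc [[g1 [Cg1 Hg1]] [g2 [Cg2 Hg2]]]];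
  (split; [exact Hc|]); [exact I|].
split; [|split].
- intros x y Hxy; split; eexists; [apply Hg1 | apply Hg2]; exact Hxy.
- apply (Cn_on_ext D HD n g1); [|auto].
  intros x y Hxy; symmetry; apply is_derive_unique; auto.
- apply (Cn_on_ext D HD n g2); [|auto].
  intros x y Hxy; symmetry; apply is_derive_unique; auto.
Qed.

(** * The function Delta *)

Lemma radicand_pos (k t : R) : -1 < k < 1 -> 0 < 1 - k ^ 2 * sin t ^ 2.
Proof.
intros Hk; pose proof (SIN_bound t).
assert (k ^ 2 < 1) by nra; assert (sin t ^ 2 <= 1) by nra.
pose proof (pow2_ge_0 k); nra.
Qed.

Definition Delta (k t : R) : R := sqrt (1 - k ^ 2 * sin t ^ 2).

Lemma Delta_pos (k t : R) : -1 < k < 1 -> 0 < Delta k t.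
Proof. intros Hk; apply sqrt_lt_R0, radicand_pos, Hk. Qed.

Lemma Delta_sqr (k t : R) : -1 < k < 1 ->
  Delta k t ^ 2 = 1 - k ^ 2 * sin t ^ 2.
Proof. intros Hk; apply pow2_sqrt, Rlt_le, radicand_pos, Hk. Qed.

Lemma Delta_le_1 (k t : R) : -1 < k < 1 -> Delta k t <= 1.
Proof.
intros Hk; pose proof (Delta_pos k t Hk); pose proof (Delta_sqr k t Hk).
pose proof (pow2_ge_0 (k * sin t)); nra.
Qed.

Lemma is_derive_Delta (k t : R) : -1 < k < 1 ->
  is_derive (Delta k) t (- (k ^ 2 * sin t * cos t) / Delta k t).
Proof.
intros Hk; pose proof (Delta_pos k t Hk) as Hd; pose proof (radicand_pos k t Hk).
unfold Delta in *; auto_derive.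
- replace (1 + - (k * (k * 1) * (sin t * (sin t * 1))))
    with (1 - k ^ 2 * sin t ^ 2) by ring; auto.
- replace (1 + - (k * (k * 1) * (sin t * (sin t * 1))))
    with (1 - k ^ 2 * sin t ^ 2) by ring.
  field; lra.
Qed.

(** * The complete integral as a smooth function of the modulus *)

(** The exponents are those for which differentiating in [k] only raises [n]:
    the factor [sin^2] produced by the radicand completes [sin^(2n+2)], and the
    power of [1 / Delta] grows by two. *)
Definition elliptic_integrand (n : nat) (k t : R) : R :=
  sin t ^ (2 * n) * (/ Delta k t) ^ (2 * n + 1).

Definition elliptic_moment (n : nat) (k : R) : R :=
  RInt (elliptic_integrand n k) 0 (PI / 2).

Lemma elliptic_integrand_continuity_2d (n : nat) (k t : R) :
  -1 < k < 1 -> continuity_2d_pt (elliptic_integrand n) k t.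
Proof.
intros Hk; pose proof (radicand_pos k t Hk) as Hp.
assert (Hsin : continuity_2d_pt (fun _ v => sin v) k t).
{ apply (continuity_1d_2d_pt_comp sin (fun _ v => v)).
  apply continuity_sin. apply continuity_2d_pt_id2. }
assert (Hpow : forall m z, continuity_pt (fun z => z ^ m) z).
{ intros m z; apply derivable_continuous_pt, derivable_pt_pow. }
apply continuity_2d_pt_mult.
- apply (continuity_1d_2d_pt_comp (fun z => z ^ (2 * n)) (fun _ v => sin v));
    auto.
- apply (continuity_1d_2d_pt_comp (fun z => (/ sqrt z) ^ (2 * n + 1))
      (fun u v => 1 - u ^ 2 * sin v ^ 2)).
  + apply continuity_pt_filterlim, (ex_derive_continuous (V := R_NormedModule)).
    auto_derive; split; [exact Hp|split; [|exact I]].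
    apply Rgt_not_eq, sqrt_lt_R0, Hp.
  + apply continuity_2d_pt_minus; [apply continuity_2d_pt_const|].
    apply continuity_2d_pt_mult.
    * apply (continuity_1d_2d_pt_comp (fun z => z ^ 2) (fun u _ => u)); auto.
      apply continuity_2d_pt_id1.
    * apply (continuity_1d_2d_pt_comp (fun z => z ^ 2) (fun _ v => sin v));
        auto.
Qed.

Lemma is_derive_elliptic_integrand (n : nat) (k t : R) : -1 < k < 1 ->
  is_derive (fun u => elliptic_integrand n u t) k
    (INR (2 * n + 1) * k * elliptic_integrand (S n) k t).
Proof.
intros Hk; pose proof (radicand_pos k t Hk) as Hp.
pose proof (sqrt_lt_R0 _ Hp) as Hs.
unfold elliptic_integrand, Delta; auto_derive.
- replace (1 + - (k * (k * 1) * (sin t * (sin t * 1))))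
    with (1 - k ^ 2 * sin t ^ 2) by ring.
  repeat split; auto; lra.
- replace (1 + - (k * (k * 1) * (sin t * (sin t * 1))))
    with (1 - k ^ 2 * sin t ^ 2) by ring.
  replace (2 * S n + 1)%nat with (S (S (S (2 * n)))) by lia.
  replace (2 * S n)%nat with (S (S (2 * n))) by lia.
  replace (n + (n + 0) + 1)%nat with (S (2 * n)) by lia.
  replace (2 * n + 1)%nat with (S (2 * n)) by lia.
  replace (n + (n + 0))%nat with (2 * n)%nat by lia.
  replace (Init.Nat.pred (S (2 * n))) with (2 * n)%nat by lia.
  set (s := sqrt (1 - k ^ 2 * sin t ^ 2)) in *.
  rewrite <- !tech_pow_Rmult.
  field; lra.
Qed.

(** Differentiation under the integral sign, legitimate because the integrand
    and its derivative are jointly continuous on a strip around [k]. *)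
Lemma is_derive_elliptic_moment (n : nat) (k : R) : -1 < k < 1 ->
  is_derive (elliptic_moment n) k
    (INR (2 * n + 1) * k * elliptic_moment (S n) k).
Proof.
intros Hk.
assert (Hint : forall m y, -1 < y < 1 ->
          ex_RInt (elliptic_integrand m y) 0 (PI / 2)).
{ intros m y Hy.
  apply (ex_RInt_continuous (V := R_CompleteNormedModule)); intros t _.
  apply continuity_pt_filterlim; intros eps Heps.
  destruct (elliptic_integrand_continuity_2d m y t Hy (mkposreal eps Heps))
    as [d Hd].
  exists d; split; [apply cond_pos|].
  intros t' [_ Ht']; apply Hd; [|exact Ht'].
  rewrite Rminus_diag, Rabs_R0; apply cond_pos. }
assert (Hloc : locally k (fun y => -1 < y < 1)).
{ apply (locally_interval _ k (-1) 1); simpl; try lra; auto. }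
replace (INR (2 * n + 1) * k * elliptic_moment (S n) k)
  with (RInt (fun t => Derive (fun u => elliptic_integrand n u t) k) 0 (PI / 2)).
- apply is_derive_RInt_param.
  + revert Hloc; apply filter_imp; intros y Hy t _; eexists.
    apply is_derive_elliptic_integrand, Hy.
  + intros t _.
    apply continuity_2d_pt_ext_loc with
      (fun u v => INR (2 * n + 1) * u * elliptic_integrand (S n) u v).
    * destruct Hloc as [d Hd]; exists d; intros u v Hu _.
      symmetry; apply is_derive_unique, is_derive_elliptic_integrand, Hd, Hu.
    * apply (continuity_2d_pt_mult (fun u _ => INR (2 * n + 1) * u)).
      -- apply (continuity_2d_pt_mult (fun _ _ => INR (2 * n + 1))).
         apply continuity_2d_pt_const. apply continuity_2d_pt_id1.
      -- apply elliptic_integrand_continuity_2d, Hk.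
  + revert Hloc; apply filter_imp; intros y Hy; apply Hint, Hy.
- unfold elliptic_moment; rewrite <- (RInt_scal (V := R_CompleteNormedModule)).
  + apply RInt_ext; intros t _.
    apply is_derive_unique, is_derive_elliptic_integrand, Hk.
  + apply Hint, Hk.
Qed.

Lemma ellipticK_elliptic_moment (k : R) : ellipticK k = elliptic_moment 0 k.
Proof.
apply RInt_ext; intros t _; unfold elliptic_integrand, Delta; simpl; ring.
Qed.

(** Functions of [(a, k)] built polynomially from the moments; a syntactic
    presentation, so that closure under both partial derivatives is the Leibniz
    rule by induction. *)
Inductive moment_algebra : (R -> R -> R) -> Prop :=
| ma_const c : moment_algebra (fun _ _ => c)
| ma_fst : moment_algebra (fun a _ => a)
| ma_snd : moment_algebra (fun _ k => k)
| ma_moment n : moment_algebra (fun _ k => elliptic_moment n k)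
| ma_plus f g : moment_algebra f -> moment_algebra g ->
    moment_algebra (fun a k => f a k + g a k)
| ma_mult f g : moment_algebra f -> moment_algebra g ->
    moment_algebra (fun a k => f a k * g a k).

Lemma moment_algebra_smooth (f : R -> R -> R) : moment_algebra f ->
  smooth_on (fun a k => a < 0 /\ 0 < k < 1) f.
Proof.
apply (smooth_on_of_closed_class _ moment_algebra).
{ intros a k [Ha Hk].
  assert (Hd : 0 < Rmin (- a) (Rmin k (1 - k))) by (repeat apply Rmin_pos; lra).
  exists (mkposreal _ Hd); simpl; intros u v Hu Hv.
  pose proof (Rmin_l (- a) (Rmin k (1 - k))).
  pose proof (Rmin_r (- a) (Rmin k (1 - k))).
  pose proof (Rmin_l k (1 - k)).
  pose proof (Rmin_r k (1 - k)).
  apply Rabs_def2 in Hu; apply Rabs_def2 in Hv; lra. }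
clear f; intros f Hf; induction Hf as [c| | |n
  |f g Hf [Cf [[f1 [Af1 Df1]] [f2 [Af2 Df2]]]] Hg [Cg [[g1 [Ag1 Dg1]] [g2 [Ag2 Dg2]]]]
  |f g Hf [Cf [[f1 [Af1 Df1]] [f2 [Af2 Df2]]]] Hg [Cg [[g1 [Ag1 Dg1]] [g2 [Ag2 Dg2]]]]].
- split; [intros; apply continuity_2d_pt_const|].
  split; (exists (fun _ _ => 0); split; [apply ma_const|intros; apply @is_derive_const]).
- split; [intros; apply continuity_2d_pt_id1|].
  split; [exists (fun _ _ => 1) | exists (fun _ _ => 0)];
    (split; [apply ma_const|intros; apply @is_derive_id || apply @is_derive_const]).
- split; [intros; apply continuity_2d_pt_id2|].
  split; [exists (fun _ _ => 0) | exists (fun _ _ => 1)];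
    (split; [apply ma_const|intros; apply @is_derive_id || apply @is_derive_const]).
- assert (HD : forall a k, a < 0 /\ 0 < k < 1 -> is_derive (elliptic_moment n) k
    (INR (2 * n + 1) * k * elliptic_moment (S n) k))
    by (intros a k [_ Hk]; apply is_derive_elliptic_moment; lra).
  split; [|split].
  + intros a k Hak; apply (continuity_1d_2d_pt_comp _ (fun _ v => v));
      [|apply continuity_2d_pt_id2].
    apply continuity_pt_filterlim, (ex_derive_continuous (V := R_NormedModule)).
    eexists; apply (HD a k Hak).
  + exists (fun _ _ => 0); split; [apply ma_const|intros; apply @is_derive_const].
  + exists (fun _ k => INR (2 * n + 1) * k * elliptic_moment (S n) k); split.
    * apply (ma_mult (fun _ k => INR (2 * n + 1) * k)); [|apply ma_moment].
      apply (ma_mult (fun _ _ => INR (2 * n + 1)));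
        [apply ma_const|apply ma_snd].
    * exact HD.
- split; [intros x y H; apply (continuity_2d_pt_plus f g); auto|].
  split; [exists (fun a k => f1 a k + g1 a k) | exists (fun a k => f2 a k + g2 a k)];
    (split; [apply ma_plus; assumption|intros x y H]).
  + apply (is_derive_plus (fun t => f t y) (fun t => g t y)); auto.
  + apply (is_derive_plus (fun t => f x t) (fun t => g x t)); auto.
- split; [intros x y H; apply (continuity_2d_pt_mult f g); auto|].
  split; [exists (fun a k => f1 a k * g a k + f a k * g1 a k)
         | exists (fun a k => f2 a k * g a k + f a k * g2 a k)];
    (split; [apply ma_plus; apply ma_mult; assumption|intros x y H]).
  + apply (is_derive_mult (fun t => f t y) (fun t => g t y));
      auto using Rmult_comm.
  + apply (is_derive_mult (fun t => f x t) (fun t => g x t));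
      auto using Rmult_comm.
Qed.

(** * The incomplete integral and its inverse, the amplitude *)

Lemma is_derive_ellipticF (k t : R) : -1 < k < 1 ->
  is_derive (fun t => ellipticF t k) t (/ Delta k t).
Proof.
intros Hk.
assert (Hc : forall s, continuous (fun s => / Delta k s) s).
{ intros s; apply (ex_derive_continuous (V := R_NormedModule)).
  apply (ex_derive_inv (Delta k)).
  - eexists; apply is_derive_Delta, Hk.
  - apply Rgt_not_eq, Delta_pos, Hk. }
apply (is_derive_RInt (V := R_NormedModule) (fun s => / Delta k s) _ 0); [|apply Hc].
apply filter_forall; intros s; apply (RInt_correct (V := R_CompleteNormedModule)).
apply (ex_RInt_continuous (V := R_CompleteNormedModule)); intros; apply Hc.
Qed.

Lemma ellipticF_continuity (k t : R) : -1 < k < 1 ->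
  continuity_pt (fun t => ellipticF t k) t.
Proof.
intros Hk; apply continuity_pt_filterlim.
apply (ex_derive_continuous (V := R_NormedModule) (fun t => ellipticF t k)).
eexists; exact (is_derive_ellipticF k t Hk).
Qed.

Lemma ellipticF_0 (k : R) : ellipticF 0 k = 0.
Proof. apply (RInt_point (V := R_CompleteNormedModule)). Qed.

(** The integrand is at least 1.  This one bound gives injectivity and
    surjectivity of [ellipticF] and the Lipschitz continuity of its inverse. *)
Lemma ellipticF_increment (k s t : R) : -1 < k < 1 -> s <= t ->
  t - s <= ellipticF t k - ellipticF s k.
Proof.
intros Hk Hst.
destruct (MVT_gen (fun t => ellipticF t k) s t (fun t => / Delta k t))
  as [c [_ Hc]].
- intros x _; exact (is_derive_ellipticF k x Hk).
- intros x _; exact (ellipticF_continuity k x Hk).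
- rewrite Hc.
  assert (1 <= / Delta k c).
  { rewrite <- Rinv_1; apply Rinv_le_contravar;
      [apply Delta_pos, Hk|apply Delta_le_1, Hk]. }
  nra.
Qed.

Lemma constant_of_is_derive_0 (f : R -> R) :
  (forall x, is_derive f x 0) -> forall x y, f x = f y.
Proof.
intros Hf x y; destruct (Rtotal_order x y) as [H|[->|H]]; [|reflexivity|];
  [|symmetry]; apply eq_is_derive; auto.
Qed.

Lemma ellipticF_opp (k t : R) : -1 < k < 1 -> ellipticF (- t) k = - ellipticF t k.
Proof.
intros Hk.
assert (H : ellipticF (- t) k + ellipticF t k = ellipticF (- 0) k + ellipticF 0 k).
{ apply (constant_of_is_derive_0 (fun t => ellipticF (- t) k + ellipticF t k)).
  intros x.
  replace 0 with (-1 * / Delta k (- x) + / Delta k x).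
  - apply (is_derive_plus (V := R_NormedModule)); [|apply is_derive_ellipticF, Hk].
    apply (is_derive_comp (fun t => ellipticF t k) Ropp).
    apply is_derive_ellipticF, Hk. auto_derive; auto.
  - unfold Delta; rewrite sin_neg.
    replace ((- sin x) ^ 2) with (sin x ^ 2) by ring; ring. }
rewrite Ropp_0, ellipticF_0 in H; lra.
Qed.

(** The increment over a period [PI] of the integrand does not depend on the
    base point; at [- PI / 2], by oddness, it is twice the quarter period. *)
Lemma ellipticF_add_PI (k t : R) : -1 < k < 1 ->
  ellipticF (t + PI) k = ellipticF t k + 2 * ellipticK k.
Proof.
intros Hk.
assert (H : forall s, ellipticF (t + PI) k - ellipticF t k
                      = ellipticF (s + PI) k - ellipticF s k).
{ apply (constant_of_is_derive_0 (fun t => ellipticF (t + PI) k - ellipticF t k)).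
  intros x.
  replace 0 with (1 * / Delta k (x + PI) - / Delta k x).
  - apply (is_derive_minus (V := R_NormedModule)); [|apply is_derive_ellipticF, Hk].
    apply (is_derive_comp (fun t => ellipticF t k) (fun x => x + PI)).
    apply is_derive_ellipticF, Hk. auto_derive; auto.
  - unfold Delta; rewrite neg_sin.
    replace ((- sin x) ^ 2) with (sin x ^ 2) by ring; ring. }
specialize (H (- (PI / 2))).
replace (- (PI / 2) + PI) with (PI / 2) in H by field.
rewrite ellipticF_opp in H by exact Hk.
unfold ellipticK; lra.
Qed.

Lemma ellipticF_surj (k u : R) : -1 < k < 1 -> exists t, ellipticF t k = u.
Proof.
intros Hk.
assert (Hm : Rmin (ellipticF (- Rabs u) k) (ellipticF (Rabs u) k) <= u
             <= Rmax (ellipticF (- Rabs u) k) (ellipticF (Rabs u) k)).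
{ pose proof (ellipticF_increment k 0 (Rabs u) Hk (Rabs_pos u)) as H.
  rewrite ellipticF_0 in H.
  rewrite ellipticF_opp by exact Hk.
  pose proof (Rle_abs u); pose proof (Rabs_maj2 u).
  rewrite Rmin_left, Rmax_right; lra. }
destruct (IVT_gen (fun t => ellipticF t k) (- Rabs u) (Rabs u) u) as [t [_ Ht]].
- intros x; exact (ellipticF_continuity k x Hk).
- exact Hm.
- exists t; exact Ht.
Qed.

Lemma jacobi_am_ellipticF (k t : R) : -1 < k < 1 -> jacobi_am (ellipticF t k) k = t.
Proof.
intros Hk.
apply (iota_unique (V := R_CompleteNormedModule)
         (fun theta : R => ellipticF theta k = ellipticF t k)); [|reflexivity].
intros y Hy; destruct (Rle_lt_dec y t) as [H|H];
  [pose proof (ellipticF_increment k y t Hk H)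
  |pose proof (ellipticF_increment k t y Hk (Rlt_le _ _ H))]; lra.
Qed.

Lemma ellipticF_jacobi_am (k u : R) : -1 < k < 1 -> ellipticF (jacobi_am u k) k = u.
Proof.
intros Hk; destruct (ellipticF_surj k u Hk) as [t <-].
rewrite jacobi_am_ellipticF; auto.
Qed.

Lemma jacobi_am_add_2K (k u : R) : -1 < k < 1 ->
  jacobi_am (u + 2 * ellipticK k) k = jacobi_am u k + PI.
Proof.
intros Hk; rewrite <- (jacobi_am_ellipticF k (jacobi_am u k + PI) Hk).
rewrite ellipticF_add_PI, ellipticF_jacobi_am; auto.
Qed.

Lemma jacobi_am_lipschitz (k u v : R) : -1 < k < 1 ->
  Rabs (jacobi_am u k - jacobi_am v k) <= Rabs (u - v).
Proof.
intros Hk.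
pose proof (ellipticF_jacobi_am k u Hk) as Hu.
pose proof (ellipticF_jacobi_am k v Hk) as Hv.
destruct (Rle_lt_dec (jacobi_am v k) (jacobi_am u k)) as [H|H].
- pose proof (ellipticF_increment k _ _ Hk H).
  rewrite Rabs_pos_eq by lra. apply Rle_trans with (u - v); [lra|apply Rle_abs].
- pose proof (ellipticF_increment k _ _ Hk (Rlt_le _ _ H)).
  rewrite Rabs_left by lra. apply Rle_trans with (v - u); [lra|].
  rewrite Rabs_minus_sym; apply Rle_abs.
Qed.

Lemma is_derive_jacobi_am (k u : R) : -1 < k < 1 ->
  is_derive (fun u => jacobi_am u k) u (Delta k (jacobi_am u k)).
Proof.
intros Hk; apply is_derive_Reals.
assert (Hder : forall a, derivable_pt_lim (fun t => ellipticF t k) a (/ Delta k a))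
  by (intros a; apply is_derive_Reals, is_derive_ellipticF, Hk).
assert (Hmon : forall v w, v <= w -> jacobi_am v k <= jacobi_am w k).
{ intros v w Hvw; apply Rnot_lt_le; intros H.
  pose proof (ellipticF_increment k _ _ Hk (Rlt_le _ _ H)) as HF.
  rewrite !ellipticF_jacobi_am in HF by exact Hk; lra. }
pose (Prf := fun a (_ : jacobi_am (u - 1) k <= a <= jacobi_am (u + 1) k) =>
       exist (fun l => derivable_pt_abs (fun t => ellipticF t k) a l) _ (Hder a)).
assert (Hin : jacobi_am (u - 1) k <= jacobi_am u k <= jacobi_am (u + 1) k)
  by (split; apply Hmon; lra).
replace (Delta k (jacobi_am u k))
  with (1 / derive_pt _ _ (Prf (jacobi_am u k) Hin)).
- apply (derivable_pt_lim_recip_interv (fun t => ellipticF t k)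
           (fun u => jacobi_am u k) (u - 1) (u + 1)); try lra.
  + intros eps Heps; exists eps; split; [exact Heps|].
    intros v [_ Hv]; simpl in *; unfold Rdist in *.
    eapply Rle_lt_trans; [apply jacobi_am_lipschitz, Hk|exact Hv].
  + intros v _; apply ellipticF_jacobi_am, Hk.
  + simpl; apply Rinv_neq_0_compat, Rgt_not_eq, Delta_pos, Hk.
- simpl; field; apply Rgt_not_eq, Delta_pos, Hk.
Qed.

(** * The differential equation of the squared cosine amplitude *)

Lemma is_derive_cn_sqr (k u : R) : -1 < k < 1 ->
  is_derive (fun u => jacobi_cn u k ^ 2) u
    (-2 * (sin (jacobi_am u k) * cos (jacobi_am u k) * Delta k (jacobi_am u k))).
Proof.
intros Hk; unfold jacobi_cn.
pose proof (is_derive_jacobi_am k u Hk) as HA.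
auto_derive; [eexists; exact HA|].
replace (Derive (fun x => jacobi_am x k) u) with (Delta k (jacobi_am u k))
  by (symmetry; apply is_derive_unique; exact HA).
ring.
Qed.

(** The factor [am' = Delta] turns the [1 / Delta] of the derivative of [Delta]
    into 1 and the remaining [Delta] into [Delta^2], so only even powers of sine
    and cosine survive: the second derivative is polynomial in [cn^2]. *)
Lemma is_derive_cn_sqr'' (k u : R) : -1 < k < 1 ->
  is_derive
    (fun u => -2 * (sin (jacobi_am u k) * cos (jacobi_am u k)
                    * Delta k (jacobi_am u k))) u
    (2 * (1 - k ^ 2) + 4 * (2 * k ^ 2 - 1) * jacobi_cn u k ^ 2
     - 6 * k ^ 2 * (jacobi_cn u k ^ 2) ^ 2).
Proof.
intros Hk.
replace (2 * (1 - k ^ 2) + 4 * (2 * k ^ 2 - 1) * jacobi_cn u k ^ 2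
     - 6 * k ^ 2 * (jacobi_cn u k ^ 2) ^ 2) with
  (Delta k (jacobi_am u k) *
   (-2 * ((cos (jacobi_am u k) ^ 2 - sin (jacobi_am u k) ^ 2) * Delta k (jacobi_am u k)
     + sin (jacobi_am u k) * cos (jacobi_am u k)
       * (- (k ^ 2 * sin (jacobi_am u k) * cos (jacobi_am u k))
          / Delta k (jacobi_am u k))))).
- apply (is_derive_comp (fun t => -2 * (sin t * cos t * Delta k t))
           (fun u => jacobi_am u k)); [|apply is_derive_jacobi_am, Hk].
  set (t := jacobi_am u k).
  pose proof (is_derive_Delta k t Hk) as HD.
  auto_derive; [eexists; exact HD|].
  replace (Derive (fun x => Delta k x) t)
    with (- (k ^ 2 * sin t * cos t) / Delta k t)
    by (symmetry; apply is_derive_unique; exact HD).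
  ring.
- unfold jacobi_cn; set (t := jacobi_am u k).
  pose proof (Delta_pos k t Hk) as Hp; pose proof (Delta_sqr k t Hk) as Hs.
  assert (Hc : sin t ^ 2 = 1 - cos t ^ 2)
    by (pose proof (sin2_cos2 t); unfold Rsqr in *; lra).
  rewrite Hc in Hs.
  transitivity (-2 * ((cos t ^ 2 - sin t ^ 2) * Delta k t ^ 2
                      - k ^ 2 * sin t ^ 2 * cos t ^ 2)); [field; lra|].
  rewrite Hc, Hs; ring.
Qed.

(** * Smoothness of solutions of an autonomous second-order equation *)

(** Polynomials in [y] and [z]; used with [z = y'], where they are stable under
    differentiation as soon as [y''] is among them. *)
Inductive jet_algebra (y z : R -> R) : (R -> R) -> Prop :=
| ja_const c : jet_algebra y z (fun _ => c)
| ja_val : jet_algebra y z y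
| ja_der : jet_algebra y z z
| ja_plus f g : jet_algebra y z f -> jet_algebra y z g ->
    jet_algebra y z (fun x => f x + g x)
| ja_mult f g : jet_algebra y z f -> jet_algebra y z g ->
    jet_algebra y z (fun x => f x * g x).

Lemma ex_derive_n_of_second_order_ode (y z w : R -> R) :
  (forall x, is_derive y x (z x)) -> (forall x, is_derive z x (w x)) ->
  jet_algebra y z w -> forall n x, ex_derive_n y n x.
Proof.
intros Hy Hz Hw.
assert (Hcl : forall f, jet_algebra y z f ->
          exists g, jet_algebra y z g /\ forall x, is_derive f x (g x)).
{ intros f Hf; induction Hf as [c| | |f g Hf [f' [Jf Df]] Hg [g' [Jg Dg]]
                               |f g Hf [f' [Jf Df]] Hg [g' [Jg Dg]]].
  - exists (fun _ => 0); split; [apply ja_const|intros; apply @is_derive_const].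
  - exists z; split; [apply ja_der|exact Hy].
  - exists w; split; [exact Hw|exact Hz].
  - exists (fun x => f' x + g' x); split; [apply ja_plus; assumption|].
    intros; apply @is_derive_plus; auto.
  - exists (fun x => f' x * g x + f x * g' x); split.
    + apply ja_plus; apply ja_mult; assumption.
    + intros; apply (is_derive_mult (K := R_AbsRing)); auto using Rmult_comm. }
assert (Hn : forall n, exists g, jet_algebra y z g /\ forall x, Derive_n y n x = g x).
{ induction n as [|n [g [Jg Hg]]].
  - exists y; split; [apply ja_val|reflexivity].
  - destruct (Hcl g Jg) as [g' [Jg' Dg']].
    exists g'; split; [exact Jg'|]; intros x; simpl.
    rewrite (Derive_ext _ g x Hg); apply is_derive_unique, Dg'. }
intros [|n] x; simpl; [exact I|].
destruct (Hn n) as [g [Jg Hg]]; destruct (Hcl g Jg) as [g' [_ Dg']].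
apply ex_derive_ext with g; [intros; symmetry; apply Hg|eexists; apply Dg'].
Qed.

(** * The cnoidal wave *)

Definition cnoidal_profile (L a k x : R) : R :=
  - (1 / 2) * (((32 * k ^ 2 - 16) * a * ellipticK k ^ 2 + L ^ 2) / L ^ 2)
  + 24 * ellipticK k ^ 2 * a * k ^ 2 / L ^ 2
    * jacobi_cn (2 * ellipticK k / L * x) k ^ 2.

Lemma cnoidal_profile_periodic (L a k x : R) : L <> 0 -> -1 < k < 1 ->
  cnoidal_profile L a k (x + L) = cnoidal_profile L a k x.
Proof.
intros HL Hk; unfold cnoidal_profile, jacobi_cn.
replace (2 * ellipticK k / L * (x + L))
  with (2 * ellipticK k / L * x + 2 * ellipticK k) by (field; exact HL).
rewrite jacobi_am_add_2K, neg_cos by exact Hk; ring.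
Qed.

(** [b0] and [b2] are exactly the values that cancel the coefficients of
    [cn^2] and [cn^4] in [a phi'' + phi + phi^2]. *)
Lemma cnoidal_profile_ode (L a k : R) : L <> 0 -> a <> 0 -> -1 < k < 1 ->
  exists (A : R) (z : R -> R),
    (forall x, is_derive (cnoidal_profile L a k) x (z x)) /\
    (forall x, is_derive z x
       ((A - cnoidal_profile L a k x - cnoidal_profile L a k x ^ 2) / a)).
Proof.
intros HL Ha Hk.
(* In terms of the frequency [s] the coefficients are polynomial in [a] and [k],
   and the quotients by [L] disappear. *)
set (s := 2 * ellipticK k / L).
set (b0 := - (1 / 2) - 2 * a * s ^ 2 * (2 * k ^ 2 - 1)).
set (b2 := 6 * a * k ^ 2 * s ^ 2).
assert (Hprof : forall x, cnoidal_profile L a k x = b0 + b2 * jacobi_cn (s * x) k ^ 2).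
{ intros x; unfold cnoidal_profile, b0, b2, s; field; exact HL. }
(* The constant terms of [phi + phi^2 + a phi''] in powers of [cn^2]. *)
exists (b0 + b0 ^ 2 + 2 * a * b2 * s ^ 2 * (1 - k ^ 2)).
exists (fun x => b2 * (s * (-2 * (sin (jacobi_am (s * x) k)
  * cos (jacobi_am (s * x) k) * Delta k (jacobi_am (s * x) k))))).
assert (Hlin : forall x, is_derive (fun x => s * x) x s)
  by (intros; auto_derive; auto; ring).
split; intros x.
- apply is_derive_ext with (fun x => b0 + b2 * jacobi_cn (s * x) k ^ 2);
    [intros; symmetry; apply Hprof|].
  rewrite <- (Rplus_0_l (b2 * _)).
  apply @is_derive_plus; [apply @is_derive_const|].
  apply is_derive_scal.
  apply (is_derive_comp (fun u => jacobi_cn u k ^ 2) (fun x => s * x)); auto.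
  apply is_derive_cn_sqr, Hk.
- rewrite Hprof.
  set (y := jacobi_cn (s * x) k ^ 2).
  replace ((b0 + b0 ^ 2 + 2 * a * b2 * s ^ 2 * (1 - k ^ 2) - (b0 + b2 * y)
            - (b0 + b2 * y) ^ 2) / a)
    with (b2 * (s * (s * (2 * (1 - k ^ 2) + 4 * (2 * k ^ 2 - 1) * y
                          - 6 * k ^ 2 * y ^ 2)))).
  + apply is_derive_scal.
    apply is_derive_scal.
    apply (is_derive_comp (fun u => -2 * (sin (jacobi_am u k) * cos (jacobi_am u k)
                    * Delta k (jacobi_am u k))) (fun x => s * x)); auto.
    apply is_derive_cn_sqr'', Hk.
  + unfold b0, b2; field; exact Ha.
Qed.

Lemma cnoidal_profile_ex_derive_n (L a k : R) : L <> 0 -> a <> 0 ->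
  -1 < k < 1 -> forall n x, ex_derive_n (cnoidal_profile L a k) n x.
Proof.
intros HL Ha Hk.
destruct (cnoidal_profile_ode L a k HL Ha Hk) as [A [z [Hy Hz]]].
set (y := cnoidal_profile L a k) in *.
apply (ex_derive_n_of_second_order_ode y z
         (fun x => / a * (A + -1 * (y x + y x * y x)))).
- exact Hy.
- intros x.
  replace (/ a * (A + -1 * (y x + y x * y x)))
    with ((A - y x - y x ^ 2) / a) by (field; exact Ha).
  apply Hz.
- repeat first [apply ja_val | apply ja_const | apply ja_plus | apply ja_mult].
Qed.

Lemma cnoidal_profile_equation (L a k : R) : L <> 0 -> a <> 0 -> -1 < k < 1 ->
  exists A, forall x,
    cnoidal_profile L a k x + cnoidal_profile L a k x ^ 2
      + a * Derive_n (cnoidal_profile L a k) 2 x = A.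
Proof.
intros HL Ha Hk.
destruct (cnoidal_profile_ode L a k HL Ha Hk) as [A [z [Hy Hz]]].
exists A; intros x; simpl Derive_n.
rewrite (Derive_ext _ z) by (intros; apply is_derive_unique, Hy).
rewrite (is_derive_unique _ _ _ (Hz x)); field; exact Ha.
Qed.

Theorem proposition3p3 (L : R) (HL : 0 < L) :
  exists b0 b2 : R -> R -> R,
    smooth_on (fun a k => a < 0 /\ 0 < k < 1) b0 /\
    smooth_on (fun a k => a < 0 /\ 0 < k < 1) b2 /\
    forall a k : R, a < 0 -> 0 < k < 1 ->
      b0 a k = - (1 / 2) *
        (((32 * k ^ 2 - 16) * a * ellipticK k ^ 2 + L ^ 2) / L ^ 2) /\
      b2 a k = 24 * ellipticK k ^ 2 * a * k ^ 2 / L ^ 2 /\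
      forall b c d : R, a = c -> c < 0 -> b = d -> 0 < d -> a + b = 1 / 6 ->
      forall B : R, B = sqrt 2 \/ B = - sqrt 2 ->
      let phi := fun x : R =>
        b0 a k + b2 a k * jacobi_cn (2 * ellipticK k / L * x) k ^ 2 in
      let psi := fun x : R => B * phi x in
      exists A1 A2 : R,
        smooth_periodic L phi /\ smooth_periodic L psi /\
        travelling_wave_system 0 a b c d A1 A2 phi psi.
Proof.
(* The coefficients are written with the moment [I_0] in place of [K], so that
   they lie in the moment algebra. *)
exists (fun a k => - (1 / 2) *
  (((32 * k ^ 2 - 16) * a * elliptic_moment 0 k ^ 2 + L ^ 2) / L ^ 2)).
exists (fun a k => 24 * elliptic_moment 0 k ^ 2 * a * k ^ 2 / L ^ 2).
split; [|split].
1, 2: apply moment_algebra_smooth;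
  repeat first [apply ma_const | apply ma_fst | apply ma_snd | apply ma_moment
               | apply ma_plus | apply ma_mult].
intros a k Ha Hk; cbv beta; rewrite <- (ellipticK_elliptic_moment k).
split; [reflexivity|split; [reflexivity|]].
intros b c d <- _ _ _ _ B HB.
change (let phi := cnoidal_profile L a k in
        let psi := fun x => B * phi x in
        exists A1 A2, smooth_periodic L phi /\ smooth_periodic L psi /\
          travelling_wave_system 0 a b a d A1 A2 phi psi).
intros phi psi.
assert (HL' : L <> 0) by lra.
assert (Ha' : a <> 0) by lra.
assert (Hk' : -1 < k < 1) by lra.
assert (HB2 : B ^ 2 = 2)
  by (pose proof (pow2_sqrt 2); destruct HB as [-> | ->]; lra).
destruct (cnoidal_profile_equation L a k HL' Ha' Hk') as [A HA].
fold phi in HA.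
assert (Hphi : smooth_periodic L phi).
{ split; [apply cnoidal_profile_ex_derive_n; auto|].
  intros x; apply cnoidal_profile_periodic; auto. }
exists (B * A), A; split; [exact Hphi|split; [split|]].
- intros n x; apply ex_derive_n_scal_l, Hphi.
- intros x; unfold psi; rewrite (proj2 Hphi); reflexivity.
- intros x; unfold psi; rewrite Derive_n_scal_l, <- (HA x).
  split; [ring|].
  replace ((B * phi x) ^ 2) with (2 * phi x ^ 2) by (rewrite <- HB2; ring).
  field.
Qed.
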